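(* Let $A,B$ be linear operators. The generalized modified splitting method $$u_{n+1}=e^{\frac16hB}\,e^{\frac12hA}\,e^{\frac23h\tilde B}\,e^{\frac12hA}\,e^{\frac16hB}\,u_n,$$ with $$\begin{aligned}\tilde B=B&+\tfrac1{48}h^2[B,[A,B]]-\tfrac1{80\cdot24}h^4[A,[A,[A,[A,B]]]]-\tfrac7{960\cdot6}h^4[B,[A,[A,[A,B]]]]\\&-\tfrac1{960\cdot2}h^4[[A,B],[A,[A,B]]]-\tfrac7{4320\cdot2}h^4[B,[B,[A,[A,B]]]]\\&+\tfrac1{2160}h^4[[B,[A,B]],[A,B]]-\tfrac{41}{103680}h^4[B,[B,[B,[A,B]]]],\end{aligned}$$ is of order $6$ for the equation $\frac{d}{dt}u=Au+Bu$.
   Context: $[X,Y]=XY-YX$. $A,B$ are linear operators; operator exponentials are read as formal power series in the time step $h$ (e.g. $A,B$ are elements of a unital associative real algebra $\mathcal A$ and one works in $\mathcal A[[h]]$). A one-step method $u_{n+1}=\Phi_h u_n$ is of order $p$ if its expansion agrees with that of the exact flow $e^{h(A+B)}$ in all terms of degree at most $p$ in $h$, i.e. $\Phi_h=e^{h(A+B)}+O(h^{p+1})$. *)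

(* Defs.v *)
From HB Require Import structures.
From mathcomp Require Import all_boot all_order all_algebra.
From mathcomp Require Import boolp functions reals.

Set Implicit Arguments.
Unset Strict Implicit.
Unset Printing Implicit Defensive.

Import Order.TTheory GRing.Theory Num.Theory.

Local Open Scope ring_scope.

Definition lie (S : pzRingType) (x y : S) : S := x * y - y * x.

Notation "⟦ x , y ⟧" := (lie x y)
  (at level 0, x, y at level 200, format "⟦ x ,  y ⟧") : ring_scope.

(* Formal power series S[[h]] in a central variable h over a possibly
   noncommutative ring S: the series \sum_n (f n) h^n is represented by f.
   Addition and scaling are those of functions nat -> S; the product is the
   Cauchy product, hence the need for a type distinct from nat -> S, on which
   functions.v puts the pointwise product. *)
Definition fps (S : Type) := nat -> S.

Definition fpsC (S : nmodType) (x : S) : fps S :=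
  fun n => if n == 0%N then x else 0.

(* the indeterminate h *)
Definition fpsX (S : pzSemiRingType) : fps S := fun n => (n == 1%N)%:R.
Arguments fpsX : clear implicits.

Definition fps_mul (S : pzSemiRingType) (f g : fps S) : fps S :=
  fun n => \sum_(i < n.+1) f i * g (n - i)%N.

Section FpsRing.
Variable S : nzRingType.
Implicit Types f g k : fps S.

HB.instance Definition _ := GRing.Zmodule.copy (fps S) (nat -> S).

Let P (n : nat) f : {poly S} := \poly_(i < n.+1) f i.

Let PE n f i : (i <= n)%N -> (P n f)`_i = f i.
Proof. by move=> le_in; rewrite coef_poly ltnS le_in. Qed.

Let fps_mulE n f g m : (m <= n)%N -> fps_mul f g m = (P n f * P n g)`_m.
Proof.
move=> le_mn; rewrite coefM; apply: eq_bigr => i _.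
rewrite !PE //; first by rewrite (leq_trans (leq_subr _ _)).
by rewrite (leq_trans _ le_mn) // -ltnS.
Qed.

Let fps_mulA : associative (@fps_mul S).
Proof.
move=> f g k; apply/funext => n.
rewrite !(@fps_mulE n) // coefM (coefM (P n (fps_mul f g))).
transitivity ((P n f * (P n g * P n k))`_n).
  rewrite coefM; apply: eq_bigr => i _; congr (_ * _).
  by rewrite PE ?leq_subr // (@fps_mulE n) // leq_subr.
rewrite mulrA coefM; apply: eq_bigr => i _; congr (_ * _).
have le_in : (i <= n)%N by rewrite -ltnS.
by rewrite PE // (@fps_mulE n).
Qed.

Let fps_mul1 : left_id (fpsC 1) (@fps_mul S).
Proof.
move=> f; apply/funext => n; rewrite /fps_mul big_ord_recl /= mul1r subn0.
by rewrite big1 ?addr0 // => i _; rewrite mul0r.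
Qed.

Let fps_mulr1 : right_id (fpsC 1) (@fps_mul S).
Proof.
move=> f; apply/funext => n; rewrite /fps_mul big_ord_recr /= subnn mulr1.
rewrite big1 ?add0r // => i _.
by rewrite /fpsC subn_eq0 leqNgt ltn_ord mulr0.
Qed.

Let fps_mulDl : left_distributive (@fps_mul S) +%R.
Proof.
move=> f g k; apply/funext => n; transitivity (fps_mul f k n + fps_mul g k n); last by [].
rewrite /fps_mul -big_split /=.
by apply: eq_bigr => i _; rewrite -mulrDl.
Qed.

Let fps_mulDr : right_distributive (@fps_mul S) +%R.
Proof.
move=> f g k; apply/funext => n; transitivity (fps_mul f g n + fps_mul f k n); last by [].
rewrite /fps_mul -big_split /=.
by apply: eq_bigr => i _; rewrite -mulrDr.
Qed.

Let fps_oner_neq0 : fpsC 1 != 0 :> fps S.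
Proof.
by apply/eqP => /(congr1 (fun f : fps S => f 0%N))/eqP; rewrite /= oner_eq0.
Qed.

HB.instance Definition _ := GRing.Zmodule_isNzRing.Build (fps S)
  fps_mulA fps_mul1 fps_mulr1 fps_mulDl fps_mulDr fps_oner_neq0.

End FpsRing.

Section FpsAlgebra.
Variables (R : pzRingType) (A : algType R).

HB.instance Definition _ := GRing.Lmodule.copy (fps A) (nat -> A).

Let fps_scaleAl (c : R) (f g : fps A) : c *: (f * g) = c *: f * g.
Proof.
apply/funext => n; rewrite [LHS]scaler_sumr.
by apply: eq_bigr => i _; rewrite scalerAl.
Qed.

HB.instance Definition _ := GRing.Lmodule_isLalgebra.Build R (fps A)
  fps_scaleAl.

Let fps_scaleAr (c : R) (f g : fps A) : c *: (f * g) = f * (c *: g).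
Proof.
apply/funext => n; rewrite [LHS]scaler_sumr.
by apply: eq_bigr => i _; rewrite scalerAr.
Qed.

HB.instance Definition _ := GRing.Lalgebra_isAlgebra.Build R (fps A)
  fps_scaleAr.

End FpsAlgebra.

Section FpsTheory.
Variables (R : pzRingType) (A : algType R).
Implicit Types (f g : fps A) (x y : A).

Lemma fps_coefD f g n : (f + g) n = f n + g n. Proof. by []. Qed.

Lemma fps_coefN f n : (- f) n = - f n. Proof. by []. Qed.

Lemma fps_coefZ (c : R) f n : (c *: f) n = c *: f n. Proof. by []. Qed.

Lemma fps_coefM f g n : (f * g) n = \sum_(i < n.+1) f i * g (n - i)%N.
Proof. by []. Qed.

Lemma fps_coefX f n : (fpsX A * f) n = if n is m.+1 then f m else 0.
Proof.
rewrite fps_coefM big_ord_recl /= mul0r add0r.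
case: n => [|n]; first by rewrite big_ord0.
rewrite big_ord_recl /= mul1r subSS subn0 big1 ?addr0 // => i _.
by rewrite /fpsX /= mul0r.
Qed.

Lemma fps_commX f : fpsX A * f = f * fpsX A.
Proof.
apply/funext => n; rewrite fps_coefX fps_coefM big_ord_recr /= subnn mulr0 addr0.
case: n => [|n]; first by rewrite big_ord0.
rewrite big_ord_recr /= subSnn mulr1 big1 ?add0r // => i _.
rewrite /fpsX subSn; last by rewrite ltnW.
by rewrite eqSS subn_eq0 leqNgt ltn_ord mulr0.
Qed.

Lemma fps_coefXn_eq0 f k n : f 0%N = 0 -> (n < k)%N -> (f ^+ k) n = 0.
Proof.
move=> f0; elim: k n => [|k IHk] // n lt_nk.
rewrite exprS fps_coefM big_ord_recl /= f0 mul0r add0r big1 // => i _.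
rewrite IHk ?mulr0 // /bump /= add1n.
case: n i lt_nk => [[]//|n] i lt_nk.
by rewrite subSS (leq_ltn_trans (leq_subr _ _)).
Qed.

End FpsTheory.

(* exp f = \sum_k f^k / k!, for a series f WITHOUT constant term, which is the
   only case in which this sum makes sense in A[[h]]. Then the terms with k > n
   do not contribute to the coefficient of h^n (see fps_expE). *)
Definition fps_exp (R : realType) (A : algType R) (f : fps A) : fps A :=
  fun n => \sum_(k < n.+1) (k`!%:R)^-1 *: (f ^+ k) n.

Lemma fps_expE (R : realType) (A : algType R) (f : fps A) (n m : nat) :
  f 0%N = 0 -> (n <= m)%N ->
  fps_exp f n = \sum_(k < m.+1) (k`!%:R)^-1 *: (f ^+ k) n.
Proof.
move=> f0 le_nm; rewrite -(big_mkord xpredT (fun k => k`!%:R^-1 *: (f ^+ k) n)).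
rewrite (big_cat_nat (n := n.+1)) //= big_mkord [X in _ + X]big_nat_cond.
rewrite [X in _ + X]big1 ?addr0 // => k /andP[/andP[lt_nk _] _].
by rewrite fps_coefXn_eq0 ?scaler0.
Qed.

Lemma fps_exprXC (R : pzRingType) (A : algType R) (x : A) (k n : nat) :
  ((fpsX A * fpsC x) ^+ k) n = if n == k then x ^+ k else 0.
Proof.
elim: k n => [|k IHk] n; first by rewrite expr0; case: n => [|n].
rewrite exprS -mulrA fps_coefX; case: n => [|n] //.
rewrite fps_coefM big_ord_recl /= subn0 big1 ?addr0 => [|i _]; last first.
  by rewrite /fpsC /= mul0r.
by rewrite /fpsC /= IHk eqSS; case: eqP => _; rewrite ?mulr0 ?exprS.
Qed.

Lemma fps_exp_ZXC (R : realType) (A : algType R) (c : R) (x : A) (n : nat) :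
  fps_exp (c *: (fpsX A * fpsC x)) n = (c ^+ n / n`!%:R) *: x ^+ n.
Proof.
rewrite /fps_exp (bigD1 ord_max) //= exprZn fps_coefZ fps_exprXC eqxx scalerA.
rewrite mulrC big1 ?addr0 // => i ne_in.
rewrite exprZn fps_coefZ fps_exprXC.
case: eqP => [eq_ni|_]; last by rewrite !scaler0.
by case/eqP: ne_in; apply/val_inj.
Qed.

(* The one-step method u_(n+1) = Phi u_n is of order p for du/dt = L u:
   Phi = e^(hL) + O(h^(p+1)). *)
Definition has_order (R : realType) (A : algType R) (p : nat)
    (Phi : fps A) (L : A) : Prop :=
  forall n, (n <= p)%N -> Phi n = fps_exp (fpsX A * fpsC L) n.

(* Main.v *)
(* Both sides are series in hA and hB with rational coefficients, and the
   coefficient of h^n involves only the words of length n.  The claim thus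
   amounts to finitely many identities between rationals, one for each of the
   127 words of length at most 6; they are checked by computing with
   noncommutative polynomials truncated at degree 6. *)
Require Import Defs.
From Stdlib Require Import QArith_base Qreduction.
From mathcomp Require Import all_boot all_order all_algebra.
From mathcomp Require Import boolp reals zify ssrZ.

Set Implicit Arguments.
Unset Strict Implicit.
Unset Printing Implicit Defensive.

Import Order.TTheory GRing.Theory Num.Theory.

Local Open Scope ring_scope.

Local Arguments Qred : simpl never.
Local Arguments Qplus : simpl never.
Local Arguments Qmult : simpl never.

(** * Embedding of the rationals [Q] in a numeric field *)

Lemma int_of_ZD (a b : Z) : int_of_Z (Z.add a b) = int_of_Z a + int_of_Z b.
Proof. by lia. Qed.

Lemma int_of_ZM (a b : Z) : int_of_Z (Z.mul a b) = int_of_Z a * int_of_Z b.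
Proof. by lia. Qed.

Section RationalCoefficients.
Variable R : numFieldType.

(** [Q] is built on binary integers and evaluates by computation, which an abstract field does not;
    coefficients are computed in [Q] and carried over by this map. *)
Definition ratQ (q : Q) : R :=
  (int_of_Z (Qnum q))%:~R / (int_of_Z (Zpos (Qden q)))%:~R.

Lemma ratQ_den_neq0 (p : positive) : (int_of_Z (Zpos p))%:~R != 0 :> R.
Proof. by rewrite intr_eq0; apply/eqP; lia. Qed.

Lemma ratQ_eq (p q : Q) : Qeq p q -> ratQ p = ratQ q.
Proof.
rewrite /Qeq => eq_pq; apply/eqP; rewrite eqr_div ?ratQ_den_neq0 // -!intrM.
by rewrite -!int_of_ZM eq_pq.
Qed.

Lemma ratQ_red (q : Q) : ratQ (Qred q) = ratQ q.
Proof. exact/ratQ_eq/Qred_correct. Qed.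

Lemma ratQD (p q : Q) : ratQ (Qplus p q) = ratQ p + ratQ q.
Proof.
rewrite /ratQ addf_div ?ratQ_den_neq0 // -!intrM -intrD.
by rewrite -!int_of_ZM -int_of_ZD.
Qed.

Lemma ratQM (p q : Q) : ratQ (Qmult p q) = ratQ p * ratQ q.
Proof. by rewrite /ratQ mulf_div -!intrM -!int_of_ZM. Qed.

Lemma ratQ_nat_frac (q : Q) (a b : nat) : (0 < b)%N ->
  q = Qmake (Z.of_nat a) (Pos.of_nat b) -> ratQ q = a%:R / b%:R.
Proof.
move=> b_gt0 ->; rewrite /ratQ /=; congr (_ / _); last first.
  (* [Pos.of_nat 0] is [1], hence the hypothesis that [b] is positive. *)
  by have -> : Pos.to_nat (Pos.of_nat b) = b by lia.
by have -> : int_of_Z (Z.of_nat a) = Posz a by lia.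
Qed.

End RationalCoefficients.

(* NCnode c l r stands for c + hA l + hB r: a trie indexed by the words in the
   two letters hA and hB, so that a word at depth n has degree n in h. *)
Inductive ncpoly := NCzero | NCnode of Q & ncpoly & ncpoly.

(** * Arithmetic of truncated noncommutative polynomials *)

Definition NCconst (c : Q) := NCnode c NCzero NCzero.

Fixpoint NCadd (s t : ncpoly) : ncpoly :=
  match s, t with
  | NCzero, _ => t
  | _, NCzero => s
  | NCnode c l r, NCnode d l' r' =>
      NCnode (Qred (Qplus c d)) (NCadd l l') (NCadd r r')
  end.

Fixpoint NCscale (c : Q) (t : ncpoly) : ncpoly :=
  if t is NCnode d l r
  then NCnode (Qred (Qmult c d)) (NCscale c l) (NCscale c r) else NCzero.

Definition NCsub s t := NCadd s (NCscale (Qmake (-1) 1) t).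

Fixpoint NCtrunc (n : nat) (t : ncpoly) : ncpoly :=
  match t, n with
  | NCzero, _ => NCzero
  | NCnode c _ _, 0%N => NCconst c
  | NCnode c l r, n'.+1 => NCnode c (NCtrunc n' l) (NCtrunc n' r)
  end.

(** The rule is $(c + hA\,l + hB\,r)\,t = c\,t + hA\,(l\,t) + hB\,(r\,t)$; a letter taken out on the
    left uses up one degree of the bound [n]. *)
Fixpoint NCmul (n : nat) (s t : ncpoly) {struct s} : ncpoly :=
  if s is NCnode c l r
  then NCadd (NCscale c (NCtrunc n t))
         (if n is n'.+1 then NCnode (Qmake 0 1) (NCmul n' l t) (NCmul n' r t)
          else NCzero)
  else NCzero.

Definition NClie n s t := NCsub (NCmul n s t) (NCmul n t s).

Definition NCpow n t k := iter k (NCmul n t) (NCconst (Qmake 1 1)).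

(** Stopping at the [n]-th power is exact through degree [n] when the constant term vanishes. *)
Definition NCexp n t :=
  foldr (fun k => NCadd (NCscale (Qmake 1 (Pos.of_nat k`!)) (NCpow n t k)))
    NCzero (iota 0 n.+1).

(** Cancellation in [NCadd] leaves nodes with coefficient 0, so zero has many tries besides
    [NCzero]. *)
Fixpoint NCis0 (t : ncpoly) : bool :=
  if t is NCnode c l r then [&& Qeq_bool c (Qmake 0 1), NCis0 l & NCis0 r]
  else true.

(** * Congruence of power series modulo $h^{n+1}$ *)

Section Truncation.
Variables (R : pzRingType) (A : algType R).
Implicit Types (f g : fps A) (n : nat).

Definition eqmodh n f g := forall m, (m <= n)%N -> f m = g m.

Lemma eqmodh_trans n f g k : eqmodh n f g -> eqmodh n g k -> eqmodh n f k.
Proof. by move=> fg gk m le_mn; rewrite fg // gk. Qed.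

Lemma eqmodh_sym n f g : eqmodh n f g -> eqmodh n g f.
Proof. by move=> fg m /fg. Qed.

Lemma eqmodhD n f g f' g' :
  eqmodh n f f' -> eqmodh n g g' -> eqmodh n (f + g) (f' + g').
Proof. by move=> ff' gg' m le_mn; rewrite !fps_coefD ff' ?gg'. Qed.

Lemma eqmodhZ n c f g : eqmodh n f g -> eqmodh n (c *: f) (c *: g).
Proof. by move=> fg m le_mn; rewrite !fps_coefZ fg. Qed.

Lemma eqmodhM n f g f' g' :
  eqmodh n f f' -> eqmodh n g g' -> eqmodh n (f * g) (f' * g').
Proof.
move=> ff' gg' m le_mn; rewrite !fps_coefM; apply: eq_bigr => i _.
rewrite ff' ?gg' // ?(leq_trans (leq_subr _ _)) //.
by rewrite (leq_trans _ le_mn) // -ltnS.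
Qed.

Lemma eqmodhX0 f : eqmodh 0 (fpsX A * f) 0.
Proof. by case=> // _; rewrite fps_coefX. Qed.

(** The degree gained from the factor [h] pays for the drop of the bound in the recursive calls of
    [NCtrunc] and [NCmul]. *)
Lemma eqmodhXS n f g : eqmodh n f g -> eqmodh n.+1 (fpsX A * f) (fpsX A * g).
Proof. by move=> fg [|m] le_mn; rewrite !fps_coefX // fg. Qed.

Lemma fps_coef_sum I (r : seq I) (F : I -> fps A) m :
  (\sum_(i <- r) F i) m = \sum_(i <- r) F i m.
Proof. by elim/big_rec2: _ => [|i y1 y2 _ <-]. Qed.

End Truncation.

(** * Soundness of the computation with tries *)

Section Evaluation.
Variables (R : realType) (A : algType R) (x y : fps A).
Let h := fpsX A.
Implicit Types (f g : fps A) (s t : ncpoly).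

(** Each letter brings its own factor [h], so for constant series [x] and [y] the length of a word
    is its degree in [h]. *)
Fixpoint NCeval t : fps A :=
  if t is NCnode c l r
  then (ratQ R c)%:A + h * x * NCeval l + h * y * NCeval r else 0.

Definition represents n t f := eqmodh n (NCeval t) f.

Lemma NCevalD s t : NCeval (NCadd s t) = NCeval s + NCeval t.
Proof.
elim: s t => [|c l IHl r IHr] [|d l' r'] /=; rewrite ?add0r ?addr0 //.
rewrite IHl IHr ratQ_red ratQD scalerDl !mulrDr.
by rewrite [X in X + _]addrACA [LHS]addrACA.
Qed.

Lemma NCevalZ c t : NCeval (NCscale c t) = ratQ R c *: NCeval t.
Proof.
elim: t => [|d l IHl r IHr] /=; first by rewrite scaler0.
by rewrite IHl IHr ratQ_red ratQM !scalerDr -!scalerAr scalerA.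
Qed.

Lemma NCeval_is0 t : NCis0 t -> NCeval t = 0.
Proof.
elim: t => //= c l IHl r IHr /and3P[/Qeq_bool_iff c0 /IHl-> /IHr->].
by rewrite (ratQ_eq _ c0) /ratQ mul0r scale0r !mulr0 !addr0.
Qed.

Lemma represents_trunc n t : represents n (NCtrunc n t) (NCeval t).
Proof.
elim: t n => [|c l IHl r IHr] [|n] //=; rewrite /represents /=.
  rewrite !mulr0 !addr0 -!mulrA -addrA -mulrDr -[X in eqmodh _ X]addr0.
  by apply: eqmodhD; [|apply/eqmodh_sym/eqmodhX0].
rewrite -!mulrA -!addrA -!mulrDr.
apply: eqmodhD; first by [].
by apply/eqmodhXS/eqmodhD; apply: eqmodhM; [|apply: IHl| |apply: IHr].
Qed.

(** Induction on the left factor with [n] general: under a letter, agreement one degree lower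
    suffices, and at [n = 0] the letter terms vanish modulo [h]. *)
Lemma NCeval_mul n s t : represents n (NCmul n s t) (NCeval s * NCeval t).
Proof.
elim: s n => [|c l IHl r IHr] n; first by rewrite /represents /= mul0r.
rewrite /represents [NCmul _ _ _]/= NCevalD NCevalZ /= !mulrDl -scalerAl mul1r.
rewrite -addrA; apply: eqmodhD; first exact/eqmodhZ/represents_trunc.
rewrite -!mulrA -!mulrDr; case: n => [|n] /=; first exact/eqmodh_sym/eqmodhX0.
rewrite /ratQ mul0r scale0r add0r -!mulrA -mulrDr.
by apply/eqmodhXS/eqmodhD; apply: eqmodhM; [|apply: IHl| |apply: IHr].
Qed.

Lemma representsD n s t f g : represents n s f -> represents n t g ->
  represents n (NCadd s t) (f + g).
Proof. by move=> sf tg; rewrite /represents NCevalD; apply: eqmodhD. Qed.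

Lemma representsZ n c t f : represents n t f ->
  represents n (NCscale c t) (ratQ R c *: f).
Proof. by move=> tf; rewrite /represents NCevalZ; apply: eqmodhZ. Qed.

Lemma representsB n s t f g : represents n s f -> represents n t g ->
  represents n (NCsub s t) (f - g).
Proof.
move=> sf tg; apply: representsD => //; rewrite -scaleN1r.
have -> : -1 = ratQ R (Qmake (-1) 1) by rewrite /ratQ /= divr1.
exact: representsZ.
Qed.

Lemma representsM n s t f g : represents n s f -> represents n t g ->
  represents n (NCmul n s t) (f * g).
Proof.
move=> sf tg; apply: (@eqmodh_trans _ _ _ _ (NCeval s * NCeval t)).
  exact: NCeval_mul.
exact: eqmodhM.
Qed.

Lemma represents_lie n s t f g : represents n s f -> represents n t g ->
  represents n (NClie n s t) ⟦f, g⟧.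
Proof. by move=> sf tg; apply: representsB; apply: representsM. Qed.

Lemma represents_x n :
  represents n (NCnode (Qmake 0 1) (NCconst (Qmake 1 1)) NCzero) (h * x).
Proof.
rewrite /represents /= /ratQ mul0r scale0r add0r !mulr0 !addr0 divr1.
by rewrite scale1r mulr1.
Qed.

Lemma represents_y n :
  represents n (NCnode (Qmake 0 1) NCzero (NCconst (Qmake 1 1))) (h * y).
Proof.
rewrite /represents /= /ratQ mul0r scale0r add0r !mulr0 add0r !addr0 divr1.
by rewrite scale1r mulr1.
Qed.

Lemma represents_pow n t f k : represents n t f ->
  represents n (NCpow n t k) (f ^+ k).
Proof.
move=> tf; elim: k => [|k IHk]; last by rewrite exprS; apply: representsM.
by rewrite /represents /= !mulr0 !addr0 /ratQ divr1 scale1r.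
Qed.

(** As [f] has no constant term, [fps_expE] gives all coefficients up to [n] the common cutoff [n];
    the exponential becomes a finite sum, matched term by term. *)
Lemma represents_exp n t f : f 0%N = 0 -> represents n t f ->
  represents n (NCexp n t) (fps_exp f).
Proof.
move=> f0 tf; apply: (@eqmodh_trans _ _ _ _
  (\sum_(k <- iota 0 n.+1) k`!%:R^-1 *: f ^+ k)) => [|m le_mn]; last first.
  by rewrite (fps_expE f0 le_mn) fps_coef_sum -(big_mkord xpredT
    (fun k => k`!%:R^-1 *: (f ^+ k) m)) /index_iota subn0.
rewrite /NCexp; elim: (iota 0 n.+1) => [|k r IHr]; first by rewrite big_nil.
rewrite big_cons; apply: representsD => //.
rewrite -div1r -(@ratQ_nat_frac R _ 1 _ (fact_gt0 k) erefl).
exact/representsZ/represents_pow.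
Qed.

(** Reflection: a boolean test on tries yields a congruence valid for all [x] and [y]. *)
Lemma eqmodh_represents n s t f g : represents n s f -> represents n t g ->
  NCis0 (NCsub s t) -> eqmodh n f g.
Proof.
move=> sf tg /NCeval_is0; rewrite NCevalD NCevalZ /ratQ divr1 scaleN1r.
by move/eqP; rewrite subr_eq0 => /eqP st m le_mn; rewrite -sf // st tg.
Qed.

End Evaluation.

(** * Brackets and powers of [h] *)

Lemma fpsCD (S : nzRingType) (x y : S) : fpsC (x + y) = fpsC x + fpsC y.
Proof. by apply/funext => -[|n] //=; rewrite -[RHS]/(0 + 0) addr0. Qed.

(** Since [h] is central, a bracket of words with [i] and [j] letters collects the power $h^{i+j}$
    that [NCeval] attaches to its letters. *)
Lemma lie_mulXn (R : pzRingType) (A : algType R) (i j : nat) (f g : fps A) :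
  ⟦fpsX A ^+ i * f, fpsX A ^+ j * g⟧ = fpsX A ^+ (i + j) * ⟦f, g⟧.
Proof.
have comm k (u : fps A) : u * fpsX A ^+ k = fpsX A ^+ k * u.
  by apply: commrX; rewrite /GRing.comm fps_commX.
rewrite /lie mulrBr exprD; congr (_ - _).
  by rewrite -!mulrA; congr (_ * _); rewrite !mulrA comm.
by rewrite -exprD addnC exprD -!mulrA; congr (_ * _); rewrite !mulrA comm.
Qed.

Lemma represents_Xlie (R : realType) (Alg : algType R) (x y f g : fps Alg)
    (n i j : nat) (s t : ncpoly) :
  represents x y n s (fpsX Alg ^+ i * f) ->
  represents x y n t (fpsX Alg ^+ j * g) ->
  represents x y n (NClie n s t) (fpsX Alg ^+ (i + j) * ⟦f, g⟧).
Proof. by rewrite -lie_mulXn; apply: represents_lie. Qed.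

Section Shift.
Variables (R : realType) (A : algType R) (x y : fps A) (n : nat).
Let h := fpsX A.
Implicit Types (f g : fps A) (s t : ncpoly).

Lemma represents_XD s t f g :
  represents x y n s (h * f) -> represents x y n t (h * g) ->
  represents x y n (NCadd s t) (h * (f + g)).
Proof. by rewrite mulrDr; apply: representsD. Qed.

Lemma represents_XB s t f g :
  represents x y n s (h * f) -> represents x y n t (h * g) ->
  represents x y n (NCsub s t) (h * (f - g)).
Proof. by rewrite mulrBr; apply: representsB. Qed.

(** A correction term of the modified operator has [k.+1] letters but only the power [k] of [h]; the
    time step in front of it supplies the missing factor. *)
Lemma represents_XZXn (c : R) q k t f : ratQ R q = c ->
  represents x y n t (h ^+ k.+1 * f) ->
  represents x y n (NCscale q t) (h * (c *: (h ^+ k * f))).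
Proof.
by move=> <- tf; rewrite -scalerAr mulrA -exprS; apply: representsZ.
Qed.

Lemma represents_expXZ (c : R) q t f : ratQ R q = c ->
  represents x y n t (h * f) ->
  represents x y n (NCexp n (NCscale q t)) (fps_exp (c *: (h * f))).
Proof.
move=> <- tf; apply: represents_exp; last exact: representsZ.
by rewrite fps_coefZ fps_coefX scaler0.
Qed.

End Shift.

Theorem mainTheorem11 (R : realType) (Alg : algType R) (opA opB : Alg) :
  let h := fpsX Alg in
  let A := fpsC opA in
  let B := fpsC opB in
  let tB : fps Alg :=
    B + (1 / 48) *: (h ^+ 2 * ⟦B, ⟦A, B⟧⟧)
      - (1 / (80 * 24)) *: (h ^+ 4 * ⟦A, ⟦A, ⟦A, ⟦A, B⟧⟧⟧⟧)
      - (7 / (960 * 6)) *: (h ^+ 4 * ⟦B, ⟦A, ⟦A, ⟦A, B⟧⟧⟧⟧)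
      - (1 / (960 * 2)) *: (h ^+ 4 * ⟦⟦A, B⟧, ⟦A, ⟦A, B⟧⟧⟧)
      - (7 / (4320 * 2)) *: (h ^+ 4 * ⟦B, ⟦B, ⟦A, ⟦A, B⟧⟧⟧⟧)
      + (1 / 2160) *: (h ^+ 4 * ⟦⟦B, ⟦A, B⟧⟧, ⟦A, B⟧⟧)
      - (41 / 103680%N%:R) *: (h ^+ 4 * ⟦B, ⟦B, ⟦B, ⟦A, B⟧⟧⟧⟧) in
  has_order 6
    (fps_exp ((1 / 6) *: (h * B)) * fps_exp ((1 / 2) *: (h * A)) *
     fps_exp ((2 / 3) *: (h * tB)) *
     fps_exp ((1 / 2) *: (h * A)) * fps_exp ((1 / 6) *: (h * B)))
    (opA + opB).
Proof.
move=> h A B tB.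
have c48 : ratQ R (Qmake 1 48) = 1 / 48 by exact: (@ratQ_nat_frac R _ 1).
(* [natrM] merges a product of denominators into one numeral; 1920 occurs both as $80\cdot 24$ and
   as $960\cdot 2$. *)
have c1920 : ratQ R (Qmake 1 1920) = 1 / (80 * 24).
  by rewrite -natrM; exact: (@ratQ_nat_frac R _ 1).
have c1920' : ratQ R (Qmake 1 1920) = 1 / (960 * 2).
  by rewrite -natrM; exact: (@ratQ_nat_frac R _ 1).
have c5760 : ratQ R (Qmake 7 5760) = 7 / (960 * 6).
  by rewrite -natrM; exact: ratQ_nat_frac.
have c8640 : ratQ R (Qmake 7 8640) = 7 / (4320 * 2).
  by rewrite -natrM; exact: ratQ_nat_frac.
have c2160 : ratQ R (Qmake 1 2160) = 1 / 2160 by exact: (@ratQ_nat_frac R _ 1).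
have c103680 : ratQ R (Qmake 41 103680) = 41 / 103680%N%:R.
  by apply: ratQ_nat_frac => //; vm_compute.
have c2 : ratQ R (Qmake 1 2) = 1 / 2 by exact: (@ratQ_nat_frac R _ 1).
have c6 : ratQ R (Qmake 1 6) = 1 / 6 by exact: (@ratQ_nat_frac R _ 1).
have c23 : ratQ R (Qmake 2 3) = 2 / 3 by exact: ratQ_nat_frac.
(* Writing [h ^+ 1], convertible to [h], starts the letter count that [represents_Xlie] adds up. *)
have rA : represents A B 6 (NCnode (Qmake 0 1) (NCconst (Qmake 1 1)) NCzero)
  (h ^+ 1 * A) := @represents_x _ _ A B 6.
have rB : represents A B 6 (NCnode (Qmake 0 1) NCzero (NCconst (Qmake 1 1)))
  (h ^+ 1 * B) := @represents_y _ _ A B 6.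
have rAB := represents_Xlie rA rB.
have rAAB := represents_Xlie rA rAB.
have rBAB := represents_Xlie rB rAB.
have rAAAB := represents_Xlie rA rAAB.
have rBAAB := represents_Xlie rB rAAB.
have rBBAB := represents_Xlie rB rBAB.
(* The nesting follows the sum defining [tB], last term outermost; what is represented is
   [h * tB]. *)
have rtB := represents_XB (represents_XD (represents_XB (represents_XB
    (represents_XB (represents_XB (represents_XD
  rB
    (represents_XZXn c48 rBAB))
    (represents_XZXn c1920 (represents_Xlie rA rAAAB)))
    (represents_XZXn c5760 (represents_Xlie rB rAAAB)))
    (represents_XZXn c1920' (represents_Xlie rAB rAAB)))
    (represents_XZXn c8640 (represents_Xlie rB rBAAB)))
    (represents_XZXn c2160 (represents_Xlie rBAB rAB)))
    (represents_XZXn c103680 (represents_Xlie rB rBBAB)).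
have rexpA := represents_expXZ c2 rA.
have rexpB := represents_expXZ c6 rB.
have rexptB := represents_expXZ c23 rtB.
have rexpAB : represents A B 6 (NCexp 6 (NCadd
    (NCnode (Qmake 0 1) (NCconst (Qmake 1 1)) NCzero)
    (NCnode (Qmake 0 1) NCzero (NCconst (Qmake 1 1)))))
    (fps_exp (h * fpsC (opA + opB))).
  rewrite fpsCD; apply: represents_exp; first exact: fps_coefX.
  rewrite mulrDr; exact: representsD rA rB.
apply: (eqmodh_represents (representsM (representsM (representsM
  (representsM rexpB rexpA) rexptB) rexpA) rexpB) rexpAB).
(* Both tries are closed terms free of [R] and [Alg], so the test on all words of length at most 6
   evaluates to [true]. *)
by vm_compute.
Qed.
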